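(* Let $(\mathcal N,J,g)$ be a Kähler manifold with Kähler form $\omega=d\tau$, and let $\mathcal M=\mathbb R\times\mathcal N$ with structure $(\phi,\xi,\eta,g^L)$ be its Sasakian lift. If $\mathcal N$ has constant holomorphic sectional curvature $c$, then $\mathcal M$ is a Sasakian manifold of constant $\phi$-sectional curvature $\bar c=c-3$.
   Context: Conventions: $2\,d\theta(X,Y)=X\theta(Y)-Y\theta(X)-\theta([X,Y])$ for a 1-form $\theta$. On a Kähler manifold $(\mathcal N,J,g)$, $\dim\mathcal N=2n$, the Kähler form is $\omega(X,Y)=g(X,JY)$; it is assumed that there is a global 1-form $\tau$ with $\omega=d\tau$. Holomorphic sectional curvature is the sectional curvature of planes spanned by $X,JX$; it is constant if it depends neither on the point nor on the plane. Sasakian lift: $\mathcal M=\mathbb R\times\mathcal N$ with projection $\pi_2:\mathcal M\to\mathcal N$ and coordinate $t$ on $\mathbb R$; $\xi=\partial_t$, $\eta=dt+\pi_2^*\tau$. A vector field $X$ on $\mathcal N$ is lifted to $X^L=X-(\tau(X)\circ\pi_2)\,\xi$ on $\mathcal M$. The $(1,1)$-tensor $\phi$ and metric $g^L$ are determined by $\phi X^L=(JX)^L$, $\phi\xi=0$, $g^L=\eta\otimes\eta+\pi_2^*g$. A Sasakian manifold is an almost contact metric manifold ($\phi^2X=-X+\eta(X)\xi$, $\eta(\xi)=1$, $g(\phi X,\phi Y)=g(X,Y)-\eta(X)\eta(Y)$) with $(\nabla_X\phi)Y=g(X,Y)\xi-\eta(Y)X$. The $\phi$-sectional curvature $K_\phi(v)$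 of a unit vector $v\in\ker\eta$ is the sectional curvature of the plane spanned by $v,\phi v$. *)

(* Defs.v *)
From HB Require Import structures.
From mathcomp Require Import all_boot all_order all_algebra.
From mathcomp Require Import all_classical all_reals all_analysis.
Set Implicit Arguments.
Unset Strict Implicit.
Unset Printing Implicit Defensive.
Import Order.TTheory GRing.Theory Num.Theory.
Import numFieldNormedType.Exports.
Local Open Scope classical_set_scope.
Local Open Scope ring_scope.

(* Tangent vectors are row vectors of coordinates, so that the matrix of a
   linear map acts on the right, as for the library's Jacobian ['J f x]. *)

(* For open [U] this is the usual class C^k: differentiability is implied by
   the continuity of the partial derivatives. *)
Fixpoint Ck (R : realType) (m k : nat) (U : set 'rV[R]_m) (f : 'rV[R]_m -> R)
    {struct k} : Prop :=
  match k with
  | 0%N => forall x, U x -> {for x, continuous f}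
  | k'.+1 => (forall x, U x -> differentiable f x) /\
             (forall i : 'I_m, Ck k' U (fun x => 'D_(delta_mx 0 i) f x))
  end.

Definition smooth_on (R : realType) (m p q : nat) (U : set 'rV[R]_m)
    (F : 'rV[R]_m -> 'M[R]_(p, q)) : Prop :=
  forall a b k, Ck k U (fun x => F x a b).

Record chart (R : realType) (T : topologicalType) (m : nat) := Chart {
  cdom : set T;
  cimg : set 'rV[R]_m;
  cmap : T -> 'rV[R]_m;
  cinv : 'rV[R]_m -> T }.

(* [cmap] is a homeomorphism of [cdom] onto [cimg] with inverse [cinv]; both
   maps are total, their values elsewhere are irrelevant. *)
Record is_chart (R : realType) (T : topologicalType) (m : nat)
    (k : chart R T m) : Prop := IsChart {
  cdom_open : open (cdom k);
  cimg_open : open (cimg k);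
  cmapK : forall p, cdom k p -> cimg k (cmap k p) /\ cinv k (cmap k p) = p;
  cinvK : forall x, cimg k x -> cdom k (cinv k x) /\ cmap k (cinv k x) = x;
  cmap_continuous : forall p, cdom k p -> {for p, continuous (cmap k)};
  cinv_continuous : forall x, cimg k x -> {for x, continuous (cinv k)} }.

Record atlas (R : realType) (m : nat) := Atlas {
  space :> topologicalType;
  idx : Type;
  chart_of : idx -> chart R space m }.

Definition img (R : realType) (m : nat) (A : atlas R m) (i : idx A) :
  set 'rV[R]_m := cimg (chart_of i).

Definition overlap (R : realType) (m : nat) (A : atlas R m) (i j : idx A) :
  set 'rV[R]_m :=
  [set x | img i x /\ cdom (chart_of j) (cinv (chart_of i) x)].

Definition transition (R : realType) (m : nat) (A : atlas R m) (i j : idx A)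
  (x : 'rV[R]_m) : 'rV[R]_m := cmap (chart_of j) (cinv (chart_of i) x).

Record smooth_manifold (R : realType) (m : nat) (A : atlas R m) : Prop :=
  SmoothManifold {
  manifold_hausdorff : hausdorff_space A;
  manifold_second_countable : @second_countable A;
  manifold_cover : forall p : A, exists i, cdom (chart_of i) p;
  manifold_chart : forall i : idx A, is_chart (chart_of i);
  manifold_transition : forall i j : idx A,
    smooth_on (overlap i j) (transition i j) }.

(* A tensor field is the family of its coordinate expressions in the charts of
   the atlas, subject to smoothness and to its transformation law. *)
Definition field (R : realType) (m : nat) (A : atlas R m) (p q : nat) :=
  idx A -> 'rV[R]_m -> 'M[R]_(p, q).

Section Tensors.
Context (R : realType) (m : nat) (A : atlas R m).

Definition smooth_field (p q : nat) (F : field A p q) : Prop :=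
  forall i, smooth_on (img i) (F i).

Definition vector_field (X : field A 1 m) : Prop :=
  smooth_field X /\
  forall i j x, overlap i j x ->
    X j (transition i j x) = X i x *m 'J (transition i j) x.

Definition one_form (a : field A m 1) : Prop :=
  smooth_field a /\
  forall i j x, overlap i j x ->
    a i x = 'J (transition i j) x *m a j (transition i j x).

Definition tensor11 (F : field A m m) : Prop :=
  smooth_field F /\
  forall i j x, overlap i j x ->
    F i x *m 'J (transition i j) x
    = 'J (transition i j) x *m F j (transition i j x).

Definition tensor02 (g : field A m m) : Prop :=
  smooth_field g /\
  forall i j x, overlap i j x ->
    g i x = 'J (transition i j) x *m g j (transition i j x)
              *m ('J (transition i j) x)^T.

End Tensors.

Definition form (R : realType) (m : nat) (a : 'M[R]_(m, 1)) (u : 'rV[R]_m) : R :=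
  (u *m a) 0 0.

Definition inner (R : realType) (m : nat) (G : 'M[R]_m) (u v : 'rV[R]_m) : R :=
  (u *m G *m v^T) 0 0.

Definition riemannian (R : realType) (m : nat) (A : atlas R m)
    (g : field A m m) : Prop :=
  tensor02 g /\
  forall i x, img i x ->
    (forall u v, inner (g i x) u v = inner (g i x) v u) /\
    (forall u, u != 0 -> 0 < inner (g i x) u u).

Section LocalGeometry.
Context (R : realType) (m : nat).
Implicit Types (X Y Z : 'rV[R]_m -> 'rV[R]_m) (G : 'rV[R]_m -> 'M[R]_m).

Definition lie X Y (x : 'rV[R]_m) : 'rV[R]_m :=
  'D_(X x) Y x - 'D_(Y x) X x.

(* Normalized by 2 da(X,Y) = X a(Y) - Y a(X) - a([X,Y]). *)
Definition ext_deriv (a : 'rV[R]_m -> 'M[R]_(m, 1)) X Y (x : 'rV[R]_m) : R :=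
  2^-1 * ('D_(X x) (fun y => form (a y) (Y y)) x
          - 'D_(Y x) (fun y => form (a y) (X y)) x
          - form (a x) (lie X Y x)).

(* Christoffel symbols of the first kind, contracted with [u] and [v]. *)
Definition christoffel1 G (x u v : 'rV[R]_m) : 'rV[R]_m :=
  \row_l (2^-1 * ('D_u (fun y => inner (G y) v (delta_mx 0 l)) x
                  + 'D_v (fun y => inner (G y) u (delta_mx 0 l)) x
                  - 'D_(delta_mx 0 l) (fun y => inner (G y) u v) x)).

Definition christoffel G (x u v : 'rV[R]_m) : 'rV[R]_m :=
  christoffel1 G x u v *m invmx (G x).

(* The Levi-Civita connection of [G]. *)
Definition cov G X Y (x : 'rV[R]_m) : 'rV[R]_m :=
  'D_(X x) Y x + christoffel G x (X x) (Y x).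

(* (nabla_X F) Y for a (1,1)-tensor F. *)
Definition cov11 G (F : 'rV[R]_m -> 'M[R]_m) X Y (x : 'rV[R]_m) : 'rV[R]_m :=
  cov G X (fun y => Y y *m F y) x - cov G X Y x *m F x.

(* R(X,Y)Z = nabla_X nabla_Y Z - nabla_Y nabla_X Z - nabla_[X,Y] Z. *)
Definition curvature G X Y Z (x : 'rV[R]_m) : 'rV[R]_m :=
  cov G X (cov G Y Z) x - cov G Y (cov G X Z) x - cov G (lie X Y) Z x.

(* R is a tensor, so its value on vectors at a point may be computed on their
   extensions with constant coordinates. *)
Definition sectional G (x u v : 'rV[R]_m) : R :=
  inner (G x) (curvature G (cst u) (cst v) (cst v) x) u
  / (inner (G x) u u * inner (G x) v v - inner (G x) u v ^+ 2).

End LocalGeometry.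

Record almost_hermitian (R : realType) (m : nat) (N : atlas R m)
    (J g : field N m m) : Prop := AlmostHermitian {
  hermitian_manifold : smooth_manifold N;
  hermitian_J : tensor11 J;
  hermitian_g : riemannian g;
  hermitian_J2 : forall i x, img i x -> J i x *m J i x = - 1%:M;
  hermitian_gJ : forall i x, img i x -> forall u v,
    inner (g i x) (u *m J i x) (v *m J i x) = inner (g i x) u v }.

Definition kahler (R : realType) (m : nat) (N : atlas R m)
    (J g : field N m m) : Prop :=
  almost_hermitian J g /\
  forall i X Y, smooth_on (img i) X -> smooth_on (img i) Y ->
  forall x, img i x -> cov11 (g i) (J i) X Y x = 0.

(* [omega = d tau], where [omega (X, Y) = g (X, J Y)]. *)
Definition kahler_potential (R : realType) (m : nat) (N : atlas R m)
    (J g : field N m m) (tau : field N m 1) : Prop :=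
  one_form tau /\
  forall i X Y, smooth_on (img i) X -> smooth_on (img i) Y ->
  forall x, img i x ->
    inner (g i x) (X x) (Y x *m J i x) = ext_deriv (tau i) X Y x.

Definition const_hol_curvature (R : realType) (m : nat) (N : atlas R m)
    (J g : field N m m) (c : R) : Prop :=
  forall i x, img i x -> forall v, v != 0 ->
    sectional (g i) x v (v *m J i x) = c.

Record almost_contact_metric (R : realType) (m : nat) (M : atlas R m)
    (phi : field M m m) (xi : field M 1 m) (eta : field M m 1)
    (g : field M m m) : Prop := AlmostContactMetric {
  contact_manifold : smooth_manifold M;
  contact_phi : tensor11 phi;
  contact_xi : vector_field xi;
  contact_eta : one_form eta;
  contact_g : riemannian g;
  contact_phi2 : forall i x, img i x -> forall u,
    u *m phi i x *m phi i x = - u + form (eta i x) u *: xi i x;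
  contact_eta_xi : forall i x, img i x -> form (eta i x) (xi i x) = 1;
  contact_gphi : forall i x, img i x -> forall u v,
    inner (g i x) (u *m phi i x) (v *m phi i x)
    = inner (g i x) u v - form (eta i x) u * form (eta i x) v }.

Definition sasakian (R : realType) (m : nat) (M : atlas R m)
    (phi : field M m m) (xi : field M 1 m) (eta : field M m 1)
    (g : field M m m) : Prop :=
  almost_contact_metric phi xi eta g /\
  forall i X Y, smooth_on (img i) X -> smooth_on (img i) Y ->
  forall x, img i x ->
    cov11 (g i) (phi i) X Y x
    = inner (g i x) (X x) (Y x) *: xi i x - form (eta i x) (Y x) *: X x.

Definition const_phi_curvature (R : realType) (m : nat) (M : atlas R m)
    (phi : field M m m) (eta : field M m 1) (g : field M m m) (c : R) : Prop :=
  forall i x, img i x -> forall v,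
    form (eta i x) v = 0 -> inner (g i x) v v = 1 ->
    sectional (g i) x v (v *m phi i x) = c.

Section SasakianLift.
Context (R : realType) (m : nat) (N : atlas R m).

(* The product R x N; the coordinates [z] of (t, p) are t followed by the
   coordinates of p. *)
Definition lift_chart (i : idx N) : chart R (R * N)%type (1 + m) :=
  @Chart R (R * N)%type (1 + m)
    [set p | cdom (chart_of i) p.2]
    [set z | cimg (chart_of i) (rsubmx z)]
    (fun p => row_mx (const_mx p.1) (cmap (chart_of i) p.2))
    (fun z => (z 0 0, cinv (chart_of i) (rsubmx z))).

Definition lift_atlas : atlas R (1 + m) :=
  @Atlas R (1 + m) (R * N)%type (idx N) lift_chart.

(* Differential of the projection onto N, and the inclusion of vectors of N as
   vectors of R x N tangent to the factor N. *)
Definition dproj : 'M[R]_(1 + m, m) := col_mx 0 1%:M.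
Definition incl : 'M[R]_(m, 1 + m) := row_mx 0 1%:M.

Definition lift_xi : field lift_atlas 1 (1 + m) :=
  fun _ _ => row_mx 1%:M 0.

Definition lift_eta (tau : field N m 1) : field lift_atlas (1 + m) 1 :=
  fun i z => col_mx 1%:M 0 + dproj *m tau i (rsubmx z).

(* The matrix of v |-> v^L = v - tau(v) xi at the point with coordinates [z]. *)
Definition hlift (tau : field N m 1) (i : idx N) (z : 'rV[R]_(1 + m)) :
    'M[R]_(m, 1 + m) :=
  incl - tau i (rsubmx z) *m lift_xi i z.

(* u |-> (J (dproj u))^L; see [hlift_phi] and [xi_phi]. *)
Definition lift_phi (J : field N m m) (tau : field N m 1) :
    field lift_atlas (1 + m) (1 + m) :=
  fun i z => dproj *m J i (rsubmx z) *m hlift tau i z.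

Definition lift_metric (g : field N m m) (tau : field N m 1) :
    field lift_atlas (1 + m) (1 + m) :=
  fun i z => lift_eta tau i z *m (lift_eta tau i z)^T
             + dproj *m g i (rsubmx z) *m dproj^T.

Lemma xi_dproj i z : lift_xi i z *m dproj = 0.
Proof. by rewrite mul_row_col mulmx0 mul0mx addr0. Qed.

Lemma hlift_dproj tau i z : hlift tau i z *m dproj = 1%:M.
Proof.
rewrite mulmxBl -mulmxA xi_dproj mulmx0 subr0 /incl /dproj mul_row_col.
by rewrite mulmx0 mulmx1 add0r.
Qed.

Lemma hlift_phi J tau i z (v : 'rV[R]_m) :
  v *m hlift tau i z *m lift_phi J tau i z
  = v *m J i (rsubmx z) *m hlift tau i z.
Proof.
by rewrite /lift_phi !mulmxA -(mulmxA v (hlift _ _ _)) hlift_dproj mulmx1.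
Qed.

Lemma xi_phi J tau i z : lift_xi i z *m lift_phi J tau i z = 0.
Proof. by rewrite /lift_phi !mulmxA xi_dproj !mul0mx. Qed.

End SasakianLift.
Arguments lift_xi {R m} N i x : rename.

(* Main.v *)
From Pilot Require Import Defs.
From HB Require Import structures.
From mathcomp Require Import all_boot all_order all_algebra.
From mathcomp Require Import all_classical all_reals all_analysis.
From mathcomp Require Import ring lra.
Import Pilot.Defs.
Import Order.TTheory GRing.Theory Num.Theory.
Import numFieldNormedType.Exports.
Set Implicit Arguments.
Unset Strict Implicit.
Unset Printing Implicit Defensive.
Local Open Scope classical_set_scope.
Local Open Scope ring_scope.

(** Write pi for the projection of M = R x N to N and S for the Levi-Civita
    connection of N. Since 2 dtau is the antisymmetric part of the derivative of
    tau and omega = dtau, Koszul's formula determines the Levi-Civita connection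
    of the lifted metric by its two components:
      pi (nabla_X Y) = S_(pi X) (pi Y) - eta(Y) J (pi X) - eta(X) J (pi Y),
      eta (nabla_X Y) = X (eta Y) - omega (pi X, pi Y).
    Because J is parallel, the covariant derivative of phi only sees the last
    terms, which gives the Sasakian identity. Differentiating once more, for
    horizontal u and v,
      pi (R(u,v)v) = R^N(pi u, pi v)(pi v) - 3 omega(pi u, pi v) J (pi v),
    and v = phi u yields sectional curvature c - 3. *)

(** * Derivatives of matrix-valued functions *)

Section MatrixCalculus.
Context {R : realType} {V : normedModType R}.

(** Reduces matrix calculus to scalar calculus: the product and transpose rules below are checked
    entry by entry through this equivalence. *)
Lemma is_derive_mxP m n (F : V -> 'M[R]_(m, n)) x v D :
  is_derive x v F D <->
  forall i j, is_derive x v (fun y => F y i j) (D i j).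
Proof.
split=> [FD i j|FD].
  have dF : derivable F x v by [].
  apply: DeriveDef; first by move/derivable_mxP : dF; exact.
  by rewrite -[D](derive_val (f:=F) (a:=x) (v:=v)) derive_mx// mxE.
have dF : derivable F x v.
  by apply/derivable_mxP => i j; have [] := FD i j.
apply: DeriveDef => //; rewrite derive_mx//; apply/matrixP => i j.
by rewrite mxE derive_val.
Qed.

Lemma is_derive_mulmx m n p (F : V -> 'M[R]_(m, n)) (G : V -> 'M[R]_(n, p))
    x v DF DG :
  is_derive x v F DF -> is_derive x v G DG ->
  is_derive x v (fun y => F y *m G y) (DF *m G x + F x *m DG).
Proof.
move=> /is_derive_mxP dF /is_derive_mxP dG; apply/is_derive_mxP => i j.
have -> : (fun y => (F y *m G y) i j) =
    \sum_(k < n) ((fun y => F y i k) * (fun y => G y k j)).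
  by apply/funext => y; rewrite mxE fct_sumE.
apply: is_derive_eq.
rewrite !mxE -big_split/=; apply: eq_bigr => k _.
by rewrite addrC; congr (_ + _); rewrite /GRing.scale/= mulrC.
Qed.

Lemma is_derive_trmx m n (F : V -> 'M[R]_(m, n)) x v DF :
  is_derive x v F DF -> is_derive x v (fun y => (F y)^T) DF^T.
Proof.
move=> /is_derive_mxP dF; apply/is_derive_mxP => i j.
by rewrite mxE; under eq_fun do rewrite mxE.
Qed.

(** One direction composes with a coordinate map; for the other, a matrix is the finite sum of its
    entries times the elementary matrices. *)
Lemma differentiable_mxP m n (F : V -> 'M[R]_(m, n)) x :
  differentiable F x <-> forall i j, differentiable (fun y => F y i j) x.
Proof.
split=> [dF i j|dF].
  apply: (differentiable_comp (g := fun M : 'M[R]_(m, n) => M i j)) => //.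
  exact: differentiable_coord.
rewrite (_ : F = \sum_(i < m) \sum_(j < n) (fun y => F y i j *: delta_mx i j)).
  apply: differentiable_sum => i; apply: differentiable_sum => j.
  exact: differentiableZl.
apply/funext => y; rewrite fct_sumE {1}(matrix_sum_delta (F y)).
by apply: eq_bigr => i _; rewrite fct_sumE.
Qed.

Lemma derivable_fctsum (I : Type) (r : seq I) (f : I -> V -> R) x v :
  (forall i, derivable (f i) x v) ->
  derivable (fun y => \sum_(i <- r) f i y) x v.
Proof.
move=> df; elim: r => [|i r ih].
  by under eq_fun do rewrite big_nil; exact: derivable_cst.
by under eq_fun do rewrite big_cons; exact: (derivableD (df i) ih).
Qed.

Lemma derivable_fctprod (I : Type) (r : seq I) (f : I -> V -> R) x v :
  (forall i, derivable (f i) x v) ->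
  derivable (fun y => \prod_(i <- r) f i y) x v.
Proof.
move=> df; elim: r => [|i r ih].
  by under eq_fun do rewrite big_nil; exact: derivable_cst.
by under eq_fun do rewrite big_cons; exact: (derivableM (df i) ih).
Qed.

Lemma derivable_det n (F : V -> 'M[R]_n) x v :
  derivable F x v -> derivable (fun y => \det (F y)) x v.
Proof.
move=> /derivable_mxP dF; rewrite /determinant.
apply: derivable_fctsum => s.
apply: derivableM; first exact: derivable_cst.
exact: derivable_fctprod.
Qed.

(** By the adjugate formula the entries of the inverse are cofactors over the determinant, both
    polynomial in the entries of [F]. *)
Lemma derivable_invmx n (F : V -> 'M[R]_n) x v :
  (\forall y \near x, F y \in unitmx) ->
  derivable F x v -> derivable (fun y => invmx (F y)) x v.
Proof.
move=> Fu dF.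
have Fx : \det (F x) != 0 by rewrite -unitfE -unitmxE; exact: nbhs_singleton Fu.
(* On a singular matrix [invmx] returns the matrix itself, so the formula is available only near
   [x], where [F] is invertible. *)
apply: (@near_eq_derivable _ _ _ (fun y => (\det (F y))^-1 *: \adj (F y))).
  by near=> y; rewrite /invmx (near Fu y).
apply/derivable_mxP => i j; under eq_fun do rewrite !mxE.
apply: derivableM; first by apply: derivableV => //; exact: derivable_det.
apply: derivableM; first exact: derivable_cst.
apply: derivable_det; apply/derivable_mxP => k l; under eq_fun do rewrite !mxE.
by move/derivable_mxP : dF; exact.
Unshelve. all: by end_near. Qed.

End MatrixCalculus.

(** * Functions of class C^k *)

(** Differentiability is local: with the differential of [f], the remainders of [f] and [g] agree
    near 0, and uniqueness of the differential then identifies ['d g x]. *)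
Lemma near_eq_differentiable (R : realFieldType) (V W : normedModType R)
    (f g : V -> W) x :
  (\near x, f x = g x) -> differentiable f x -> differentiable g x.
Proof.
move=> fg df.
have fgx : f x = g x by exact: nbhs_singleton fg.
have gE : g \o shift x = cst (g x) + 'd f x +o_ (0 : V) id.
  have /eqaddoP fE := diff_locally df; apply/eqaddoP => e e0.
  have fg0 : \forall y \near (0 : V), f (y + x) = g (y + x).
    by move: fg; rewrite (near_shift 0)/= subr0.
  near=> y.
  have <- : (f \o shift x - (cst (f x) + 'd f x)) y =
            (g \o shift x - (cst (g x) + 'd f x)) y.
    have fgy : f (y + x) = g (y + x) by near: y.
    by rewrite /GRing.add/GRing.opp/= fgx fgy.
  by near: y; exact: fE.
have dgE : 'd g x = 'd f x :> (V -> W).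
  by apply: diff_unique => //; exact: diff_continuous.
apply/diff_locallyP; rewrite dgE; split => //; exact: diff_continuous.
Unshelve. all: by end_near. Qed.

Section CkCalculus.
Context {R : realType} {m : nat}.
Implicit Types (U : set 'rV[R]_m) (f g : 'rV[R]_m -> R).

Lemma CkW k U f : Ck k.+1 U f -> Ck k U f.
Proof.
elim: k U f => [|k ih] U f [df Cf].
  by move=> x Ux; exact/differentiable_continuous/df.
by split=> // i; exact/ih/Cf.
Qed.

(** On an open set an equality of functions passes to their partial derivatives. This allows the
    rules of differentiation, valid only on [U], to be used under [Ck]. *)
Lemma eq_Ck k U f g :
  open U -> (forall x, U x -> f x = g x) -> Ck k U f -> Ck k U g.
Proof.
move=> oU; elim: k f g => [|k ih] f g fg;
  have nfg x : U x -> \forall y \near x, f y = g y by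
    move=> Ux; apply: filterS fg _; apply: open_nbhs_nbhs.
  move=> Cf x Ux; rewrite /prop_for /continuous_at -fg//.
  apply: cvg_trans (Cf x Ux); exact: near_eq_cvg (nfg x Ux).
move=> [df Cf]; split.
  move=> x Ux; apply: near_eq_differentiable (df x Ux).
  exact: nfg.
move=> i; apply: ih (Cf i) => x Ux; apply: near_eq_derive.
exact: nfg.
Qed.

Lemma Ck_cst k U (a : R) : Ck k U (cst a).
Proof.
elim: k a => [|k ih] a; first by move=> x _; exact: cst_continuous.
split=> [x _|i]; first exact: differentiable_cst.
by under [X in Ck _ _ X]eq_fun do rewrite derive_cst; exact: ih.
Qed.

Lemma Ck_coord k U a b : Ck k U (fun x => x a b).
Proof.
case: k => [|k]; first by move=> x _; exact: coord_continuous.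
split=> [x _|i]; first exact: differentiable_coord.
rewrite (_ : (fun _ => _) = cst ((delta_mx 0 i : 'rV[R]_m) a b)).
  exact: Ck_cst.
apply/funext => x.
have /is_derive_mxP/(_ a b) D := is_derive_id x (delta_mx 0 i : 'rV[R]_m).
by rewrite (@derive_val _ _ _ _ _ _ _ D).
Qed.

Lemma CkD k U f g : open U -> Ck k U f -> Ck k U g -> Ck k U (fun x => f x + g x).
Proof.
move=> oU; elim: k f g => [|k ih] f g.
  by move=> Cf Cg x Ux; exact: (cvgD (Cf x Ux) (Cg x Ux)).
move=> [df Cf] [dg Cg]; split=> [x Ux|i].
  by apply: differentiableD; [exact: df|exact: dg].
apply: eq_Ck (ih _ _ (Cf i) (Cg i)) => // x Ux.
by rewrite deriveD//; apply: diff_derivable; [exact: df|exact: dg].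
Qed.

(** Leibniz' rule multiplies a derivative of one factor by the other factor itself, whose class is
    lowered by one with [CkW] for the induction. *)
Lemma CkM k U f g : open U -> Ck k U f -> Ck k U g -> Ck k U (fun x => f x * g x).
Proof.
move=> oU; elim: k f g => [|k ih] f g.
  by move=> Cf Cg x Ux; exact: (cvgM (Cf x Ux) (Cg x Ux)).
move=> Hf Hg; have [[df Cf] [dg Cg]] := (Hf, Hg); split=> [x Ux|i].
  by apply: differentiableM; [exact: df|exact: dg].
apply: eq_Ck (CkD oU (ih _ _ (CkW Hf) (Cg i)) (ih _ _ (CkW Hg) (Cf i))) => // x Ux.
by rewrite deriveM//; apply: diff_derivable; [exact: df|exact: dg].
Qed.

Lemma Ck_sum k U (I : Type) (r : seq I) (F : I -> 'rV[R]_m -> R) :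
  open U -> (forall i, Ck k U (F i)) -> Ck k U (fun x => \sum_(i <- r) F i x).
Proof.
move=> oU CF; elim: r => [|i r ih].
  by under [X in Ck _ _ X]eq_fun do rewrite big_nil; exact: Ck_cst.
by under [X in Ck _ _ X]eq_fun do rewrite big_cons; exact: CkD.
Qed.

Lemma smooth_cst p q U (A : 'M[R]_(p, q)) : smooth_on U (cst A).
Proof. by move=> a b k; exact: Ck_cst. Qed.

Lemma smoothD p q U (F G : 'rV[R]_m -> 'M[R]_(p, q)) : open U ->
  smooth_on U F -> smooth_on U G -> smooth_on U (fun x => F x + G x).
Proof.
move=> oU SF SG a b k; under [X in Ck _ _ X]eq_fun do rewrite mxE.
exact: CkD (SF a b k) (SG a b k).
Qed.

Lemma smooth_mulmx p q r U (F : 'rV[R]_m -> 'M[R]_(p, q))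
    (G : 'rV[R]_m -> 'M[R]_(q, r)) : open U ->
  smooth_on U F -> smooth_on U G -> smooth_on U (fun x => F x *m G x).
Proof.
move=> oU SF SG a b k; under [X in Ck _ _ X]eq_fun do rewrite mxE.
by apply: Ck_sum => // j; exact: CkM (SF a j k) (SG j b k).
Qed.

Lemma smooth_trmx p q U (F : 'rV[R]_m -> 'M[R]_(p, q)) :
  smooth_on U F -> smooth_on U (fun x => (F x)^T).
Proof.
by move=> SF a b k; under [X in Ck _ _ X]eq_fun do rewrite mxE; exact: SF.
Qed.

Lemma smoothN p q U (F : 'rV[R]_m -> 'M[R]_(p, q)) : open U ->
  smooth_on U F -> smooth_on U (fun x => - F x).
Proof.
move=> oU SF; rewrite (_ : (fun _ => _) = (fun x => cst (- 1%:M) x *m F x)).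
  by apply: smooth_mulmx => //; exact: smooth_cst.
by apply/funext => x; rewrite /cst mulNmx mul1mx.
Qed.

Lemma smooth_differentiable p q U (F : 'rV[R]_m -> 'M[R]_(p, q)) x :
  smooth_on U F -> U x -> differentiable F x.
Proof.
by move=> SF Ux; apply/differentiable_mxP => i j; have [+ _] := SF i j 1; exact.
Qed.

(** [Ck] speaks of basis directions only; by linearity of the differential, any other directional
    derivative is a constant combination of those. *)
Lemma Ck_derive k U f u : open U -> Ck k.+1 U f -> Ck k U (fun x => 'D_u f x).
Proof.
move=> oU [df Cf].
apply: (@eq_Ck _ _ (fun x => \sum_(i < m) u 0 i * 'D_(delta_mx 0 i) f x)) => //.
  move=> x Ux; rewrite [in RHS](row_sum_delta u) deriveE; last exact: df.
  rewrite linear_sum; apply: eq_bigr => i _.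
  by rewrite linearZ/= deriveE//; exact: df.
by apply: Ck_sum => // i; exact: CkM oU (Ck_cst k U (u 0 i)) (Cf i).
Qed.

Lemma smooth_derive p q U (F : 'rV[R]_m -> 'M[R]_(p, q)) u : open U ->
  smooth_on U F -> smooth_on U (fun x => 'D_u F x).
Proof.
move=> oU SF a b k; apply: eq_Ck (Ck_derive u oU (SF a b k.+1)) => // x Ux.
by rewrite derive_mx ?mxE//; exact/diff_derivable/(smooth_differentiable SF).
Qed.

End CkCalculus.

(** * The Levi-Civita connection in coordinates *)

Section Algebra.
Context {R : realType} {m : nat}.
Implicit Types (G : 'M[R]_m) (a b : 'M[R]_(m, 1)) (u v w : 'rV[R]_m).

Lemma form_add a u v : form a (u + v) = form a u + form a v.
Proof. by rewrite /form mulmxDl mxE. Qed.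

Lemma form_sub a u v : form a (u - v) = form a u - form a v.
Proof. by rewrite /form mulmxBl !mxE. Qed.

Lemma form_scale a k u : form a (k *: u) = k * form a u.
Proof. by rewrite /form -scalemxAl mxE. Qed.

Lemma innerDl G u v w : inner G (u + v) w = inner G u w + inner G v w.
Proof. by rewrite /inner !mulmxDl mxE. Qed.

Lemma innerZl G k u w : inner G (k *: u) w = k * inner G u w.
Proof. by rewrite /inner -!scalemxAl mxE. Qed.

Lemma innerZr G k u w : inner G w (k *: u) = k * inner G w u.
Proof. by rewrite /inner linearZ/= -scalemxAr mxE. Qed.

Lemma innerNl G u w : inner G (- u) w = - inner G u w.
Proof. by rewrite -scaleN1r innerZl mulN1r. Qed.

Lemma innerNr G u w : inner G w (- u) = - inner G w u.
Proof. by rewrite -scaleN1r innerZr mulN1r. Qed.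

Lemma inner0l G w : inner G 0 w = 0.
Proof. by rewrite /inner !mul0mx mxE. Qed.

Lemma form_scaler p a u (r : 'rV[R]_p) : form a u *: r = u *m a *m r.
Proof. by rewrite /form [u *m a in RHS]mx11_scalar mul_scalar_mx. Qed.

Lemma form_mul p (Q : 'M[R]_(p, m)) a (u : 'rV[R]_p) :
  form (Q *m a) u = form a (u *m Q).
Proof. by rewrite /form mulmxA. Qed.

Lemma innerDm G G' u v : inner (G + G') u v = inner G u v + inner G' u v.
Proof. by rewrite /inner mulmxDr mulmxDl mxE. Qed.

Lemma inner_outer a b u v : inner (a *m b^T) u v = form a u * form b v.
Proof.
rewrite /inner -!mulmxA -trmx_mul mulmxA [u *m a]mx11_scalar mul_scalar_mx.
by rewrite mxE [_^T _ _]mxE.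
Qed.

Lemma inner_congr p (Q : 'M[R]_(p, m)) G (u v : 'rV[R]_p) :
  inner (Q *m G *m Q^T) u v = inner G (u *m Q) (v *m Q).
Proof. by rewrite /inner !mulmxA trmx_mul !mulmxA. Qed.

Lemma inner_sumr G u w : inner G u w = \sum_l w 0 l * inner G u (delta_mx 0 l).
Proof.
rewrite {1}(row_sum_delta w) /inner linear_sum/= mulmx_sumr summxE.
by apply: eq_bigr => l _; rewrite linearZ/= -scalemxAr mxE.
Qed.

Lemma inner_inj G (u v : 'rV[R]_m) : G \in unitmx ->
  (forall w, inner G u w = inner G v w) -> u = v.
Proof.
move=> Gu uv; apply: (can_inj (mulmxK Gu)); apply/rowP => l.
have := uv (delta_mx 0 l); rewrite /inner trmx_delta.
by rewrite -!colE !mxE.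
Qed.

(** A nonzero vector in the kernel of a singular [G] would have norm zero. *)
Lemma posdef_unitmx G : (forall u, u != 0 -> 0 < inner G u u) -> G \in unitmx.
Proof.
move=> G0; rewrite unitmxE unitfE; apply/negP => /det0P[v v0 vG].
by have := G0 v v0; rewrite /inner vG mul0mx mxE ltxx.
Qed.

End Algebra.

(** * Christoffel symbols, covariant derivative and curvature of a metric *)

Section LeviCivita.
Context {R : realType} {m : nat}.
Implicit Types (G F : 'rV[R]_m -> 'M[R]_m) (x u v w : 'rV[R]_m).

Lemma derive_form (a : 'rV[R]_m -> 'M[R]_(m, 1)) x u v : derivable a x u ->
  'D_u (fun y => form (a y) v) x = form ('D_u a x) v.
Proof.
move=> /derivableP da.
have /is_derive_mxP/(_ 0 0) D := is_derive_mulmx (is_derive_cst v x u) da.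
rewrite [LHS]derive_val /form.
by rewrite mul0mx add0r.
Qed.

Lemma derive_inner G x u v w : derivable G x u ->
  'D_u (fun y => inner (G y) v w) x = inner ('D_u G x) v w.
Proof.
move=> /derivableP dG.
have D1 := is_derive_mulmx (is_derive_cst v x u) dG.
have /is_derive_mxP/(_ 0 0) D := is_derive_mulmx D1 (is_derive_cst w^T x u).
rewrite [LHS]derive_val /inner.
by rewrite mul0mx add0r mulmx0 addr0.
Qed.

(* [D a] stands for the derivative of the metric in the direction [a]. *)
Definition koszul (D : 'rV[R]_m -> 'M[R]_m) u v w : R :=
  2^-1 * (inner (D u) v w + inner (D v) u w - inner (D w) u v).

(** Linearity in the last argument, needed to pass from the basis vectors in [christoffel1] to an
    arbitrary [w]. *)
Lemma koszul_sum (D : 'rV[R]_m -> 'M[R]_m) u v w :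
  D w = \sum_l w 0 l *: D (delta_mx 0 l) ->
  koszul D u v w = \sum_l w 0 l * koszul D u v (delta_mx 0 l).
Proof.
move=> Dw; rewrite /koszul (inner_sumr (D u)) (inner_sumr (D v)).
have -> : inner (D w) u v = \sum_l w 0 l * inner (D (delta_mx 0 l)) u v.
  rewrite Dw /inner mulmx_sumr mulmx_suml summxE.
  by apply: eq_bigr => l _; rewrite -scalemxAr -scalemxAl mxE.
rewrite -big_split -sumrB mulr_sumr; apply: eq_bigr => l _ /=.
by rewrite -mulrDr -mulrBr mulrCA.
Qed.

Lemma derive_delta_sum p q (F : 'rV[R]_m -> 'M[R]_(p, q)) x w :
  differentiable F x ->
  'D_w F x = \sum_l w 0 l *: 'D_(delta_mx 0 l) F x.
Proof.
move=> dF; rewrite {1}(row_sum_delta w) (deriveE _ dF) linear_sum.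
by apply: eq_bigr => l _; rewrite linearZ/= -(deriveE _ dF).
Qed.

Lemma christoffel1E G x u v l : differentiable G x ->
  christoffel1 G x u v 0 l = koszul (derive G x) u v (delta_mx 0 l).
Proof.
move=> dG; have dGw w : derivable G x w by exact: diff_derivable.
by rewrite mxE (derive_inner _ _ (dGw u)) (derive_inner _ _ (dGw v))
  (derive_inner _ _ (dGw (delta_mx 0 l))).
Qed.

Lemma inner_christoffel G x u v w : differentiable G x -> G x \in unitmx ->
  inner (G x) (christoffel G x u v) w = koszul (derive G x) u v w.
Proof.
move=> dG Gu; rewrite koszul_sum; last exact: derive_delta_sum.
rewrite /inner /christoffel (mulmxKV Gu) mxE.
by apply: eq_bigr => l _; rewrite (christoffel1E _ _ _ dG) mxE mulrC.
Qed.

(** Nondegeneracy of the metric. It identifies the symbols of the lift by pairing a candidate with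
    every [w], without inverting the lifted metric. *)
Lemma christoffel_unique G x u v (W : 'rV[R]_m) :
  differentiable G x -> G x \in unitmx ->
  (forall w, inner (G x) W w = koszul (derive G x) u v w) ->
  christoffel G x u v = W.
Proof.
move=> dG Gu GW; apply: (inner_inj Gu) => w.
by rewrite GW; exact: inner_christoffel.
Qed.

(** Removes the bracket term from the curvature of constant fields, which commute. *)
Lemma christoffel0l G x v : christoffel G x 0 v = 0.
Proof.
rewrite /christoffel; suff -> : christoffel1 G x 0 v = 0 by rewrite mul0mx.
apply/rowP => l; rewrite !mxE derive0.
rewrite (_ : (fun y => inner (G y) 0 _) = cst 0); last first.
  by apply/funext => y; rewrite inner0l.
rewrite (_ : (fun y => inner (G y) 0 v) = cst 0); last first.
  by apply/funext => y; rewrite inner0l.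
by rewrite !derive_cst addr0 subr0 mulr0.
Qed.

(** The derivative of [Y] occurs in both terms of [cov11] and cancels, so only the value of [Y] at
    [x] remains. *)
Lemma cov11E G F (X Y : 'rV[R]_m -> 'rV[R]_m) x :
  derivable F x (X x) -> derivable Y x (X x) ->
  cov11 G F X Y x = Y x *m 'D_(X x) F x + christoffel G x (X x) (Y x *m F x)
                    - christoffel G x (X x) (Y x) *m F x.
Proof.
move=> /derivableP dF /derivableP dY; rewrite /cov11 /cov.
have D := is_derive_mulmx dY dF; rewrite derive_val mulmxDl.
by rewrite opprD addrACA -[RHS]addrA; congr (_ + _); rewrite addrAC subrr add0r.
Qed.

Lemma cov_cst G u v : cov G (cst u) (cst v) = fun x => christoffel G x u v.
Proof. by apply/funext => x; rewrite /cov derive_cst add0r. Qed.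

Lemma curvature_cst G u v w x :
  curvature G (cst u) (cst v) (cst w) x =
  'D_u (fun y => christoffel G y v w) x + christoffel G x u (christoffel G x v w)
  - ('D_v (fun y => christoffel G y u w) x
     + christoffel G x v (christoffel G x u w)).
Proof.
have lie0 : lie (cst u) (cst v) = cst 0.
  by apply/funext => y; rewrite /lie !derive_cst subrr.
by rewrite /curvature lie0 !cov_cst christoffel0l subr0.
Qed.

(** The symbols of the first kind are combinations of first derivatives of [G], again smooth; they
    are multiplied by the inverse of [G], handled by [derivable_invmx]. *)
Lemma derivable_christoffel (U : set 'rV[R]_m) G x u v w : open U -> smooth_on U G ->
  (forall y, U y -> G y \in unitmx) -> U x ->
  derivable (fun y => christoffel G y u v) x w.
Proof.
move=> oU SG Gu Ux; rewrite /christoffel.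
have nU : \forall y \near x, U y by apply: open_nbhs_nbhs; split.
have dG y : U y -> differentiable G y by exact: smooth_differentiable.
have dinv : derivable (fun y => invmx (G y)) x w.
  apply: derivable_invmx; first by apply: filterS nU.
  exact/diff_derivable/dG.
suff d1 : derivable (fun y => christoffel1 G y u v) x w.
  by have [] := is_derive_mulmx (derivableP d1) (derivableP dinv).
apply/derivable_mxP => i l; rewrite (ord1 i).
have dD a : differentiable (fun y => 'D_a G y) x.
  by apply: smooth_differentiable Ux; exact: smooth_derive.
have di a b c : derivable (fun y => inner ('D_a G y) b c) x w.
  have D := derivableP (@diff_derivable _ _ _ _ _ w (dD a)).
  have D1 := is_derive_mulmx (is_derive_cst b x w) D.
  by have /is_derive_mxP/(_ 0 0)[] := is_derive_mulmx D1 (is_derive_cst c^T x w).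
apply: (@near_eq_derivable _ _ _ (fun y => koszul (derive G y) u v (delta_mx 0 l))).
  by apply: filterS nU => y Uy; rewrite christoffel1E//; exact: dG.
apply: derivableM; first exact: derivable_cst.
by apply: derivableB => //; exact: derivableD.
Qed.

End LeviCivita.

(** * The lifted tensors in a chart *)

Section LiftAlgebra.
Context {R : realType} {m : nat} {N : atlas R m}.
Variables (J g : field N m m) (tau : field N m 1).
Implicit Types (i : idx N) (z u v w : 'rV[R]_(1 + m)).

Local Notation P := (dproj R m).
Local Notation eta := (lift_eta tau).
Local Notation H := (hlift tau).

(** Turns the coordinate projection into a product with a constant matrix, the form used by
    [xi_dproj] and [hlift_dproj]. *)
Lemma rsubmxE (p : nat) (A : 'M[R]_(p, 1 + m)) : rsubmx A = A *m P.
Proof. by rewrite -{2}[A]hsubmxK mul_row_col mulmx0 mulmx1 add0r. Qed.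

Lemma xi_eta i z : lift_xi N i z *m eta i z = 1%:M.
Proof.
by rewrite mulmxDr mulmxA xi_dproj mul0mx addr0 mul_row_col mulmx1 mul0mx addr0.
Qed.

Lemma hlift_eta i z : H i z *m eta i z = 0.
Proof.
rewrite mulmxDr mulmxA hlift_dproj mul1mx mulmxBl -mulmxA.
rewrite /lift_xi /incl !mul_row_col !mul1mx !mulmx0 !mul0mx !addr0.
by rewrite mulmx1 sub0r addNr.
Qed.

(** The block identity eta xi + P H = 1, in which the terms in tau cancel: the tangent space splits
    into the line of xi and the kernel of eta. *)
Lemma lift_decomp i z u :
  u = form (eta i z) u *: lift_xi N i z + u *m P *m H i z.
Proof.
rewrite form_scaler -mulmxA -(mulmxA u) -mulmxDr -[LHS]mulmx1; congr (_ *m _).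
rewrite /lift_eta /hlift mulmxDl mulmxBr !mulmxA addrACA subrr addr0.
rewrite /lift_xi /incl /dproj !mul_col_row add_block_mx.
by rewrite !mulmx1 !mul0mx !mulmx0 !addr0 !add0r -scalar_mx_block.
Qed.

(** The vector identities of the almost contact structure and of [cov11_lift] are proved through
    this pair of components. *)
Lemma lift_ext i z u v :
  u *m P = v *m P -> form (eta i z) u = form (eta i z) v -> u = v.
Proof.
by move=> Puv euv; rewrite (lift_decomp i z u) (lift_decomp i z v) Puv euv.
Qed.

Lemma phi_dproj i z : lift_phi J tau i z *m P = P *m J i (rsubmx z).
Proof. by rewrite -mulmxA hlift_dproj mulmx1. Qed.

Lemma phi_eta i z : lift_phi J tau i z *m eta i z = 0.
Proof. by rewrite -mulmxA hlift_eta mulmx0. Qed.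

Lemma inner_lift i z u v :
  inner (lift_metric g tau i z) u v =
  form (eta i z) u * form (eta i z) v + inner (g i (rsubmx z)) (u *m P) (v *m P).
Proof. by rewrite innerDm inner_outer inner_congr. Qed.

Lemma inner_lift_xi i z w :
  inner (lift_metric g tau i z) (lift_xi N i z) w = form (eta i z) w.
Proof.
by rewrite inner_lift xi_dproj inner0l addr0 /form xi_eta mxE mul1r.
Qed.

Lemma inner_hlift i z (a : 'rV[R]_m) w :
  inner (lift_metric g tau i z) (a *m H i z) w = inner (g i (rsubmx z)) a (w *m P).
Proof.
rewrite inner_lift -mulmxA hlift_dproj mulmx1 /form -mulmxA hlift_eta mulmx0.
by rewrite mxE mul0r add0r.
Qed.

End LiftAlgebra.

(** * Derivatives of functions pulled back from N and of the lifted tensors *)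

Section LiftDerivative.
Context {R : realType} {m : nat} {N : atlas R m}.
Variables (J g : field N m m) (tau : field N m 1).
Implicit Types (i : idx N) (z u v w : 'rV[R]_(1 + m)).

Local Notation P := (dproj R m).
Local Notation eta := (lift_eta tau).
Local Notation H := (hlift tau).

Lemma rsubmx_shift z u (h : R) : rsubmx (h *: u + z) = h *: (u *m P) + rsubmx z.
Proof. by rewrite !rsubmxE mulmxDl scalemxAl. Qed.

Lemma growth_rate_rsubmx (V : normedModType R) (F : 'rV[R]_m -> V) z u :
  (fun h : R => h^-1 *: (((fun y => F (rsubmx y)) \o shift z) (h *: u)
                         - F (rsubmx z))) =
  (fun h : R => h^-1 *: ((F \o shift (rsubmx z)) (h *: (u *m P))
                         - F (rsubmx z))).
Proof. by apply/funext => h /=; rewrite rsubmx_shift. Qed.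

(** The projection is linear, so the two difference quotients coincide before any limit is taken. *)
Lemma derive_rsubmx (V : normedModType R) (F : 'rV[R]_m -> V) z u :
  'D_u (fun y : 'rV[R]_(1 + m) => F (rsubmx y)) z = 'D_(u *m P) F (rsubmx z).
Proof. by rewrite /derive growth_rate_rsubmx. Qed.

Lemma derivable_rsubmx (V : normedModType R) (F : 'rV[R]_m -> V) z u :
  derivable F (rsubmx z) (u *m P) ->
  derivable (fun y : 'rV[R]_(1 + m) => F (rsubmx y)) z u.
Proof. by rewrite /derivable growth_rate_rsubmx. Qed.

Lemma is_derive_rsubmx (V : normedModType R) (F : 'rV[R]_m -> V) z u :
  derivable F (rsubmx z) (u *m P) ->
  is_derive z u (fun y : 'rV[R]_(1 + m) => F (rsubmx y)) ('D_(u *m P) F (rsubmx z)).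
Proof.
move=> dF; rewrite -derive_rsubmx; exact/derivableP/derivable_rsubmx.
Qed.

Lemma is_derive_lift_eta i z u : derivable (tau i) (rsubmx z) (u *m P) ->
  is_derive z u (eta i) (P *m 'D_(u *m P) (tau i) (rsubmx z)).
Proof.
move=> /is_derive_rsubmx dt.
have D := is_derive_mulmx (is_derive_cst P z u) dt.
have D' := is_deriveD (is_derive_cst (col_mx 1%:M 0 : 'M[R]_(1 + m, 1)) z u) D.
by rewrite add0r mul0mx add0r in D'.
Qed.

Lemma is_derive_lift_metric i z u :
  derivable (tau i) (rsubmx z) (u *m P) ->
  derivable (g i) (rsubmx z) (u *m P) ->
  let T := P *m 'D_(u *m P) (tau i) (rsubmx z) in
  is_derive z u (lift_metric g tau i)
    (T *m (eta i z)^T + eta i z *m T^T + P *m 'D_(u *m P) (g i) (rsubmx z) *m P^T).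
Proof.
move=> /is_derive_lift_eta de /is_derive_rsubmx dg T.
have D := is_derive_mulmx (is_derive_cst P z u) dg.
have D' := is_derive_mulmx D (is_derive_cst P^T z u).
rewrite mulmx0 addr0 mul0mx add0r in D'.
exact: is_deriveD (is_derive_mulmx de (is_derive_trmx de)) D'.
Qed.

End LiftDerivative.

(** * Smoothness of the lifted tensors *)

Section LiftSmooth.
Context {R : realType} {m : nat}.
Implicit Type (U : set 'rV[R]_m).

Lemma open_rsubmx U : open U -> open [set z : 'rV[R]_(1 + m) | U (rsubmx z)].
Proof. by move=> oU; apply: open_comp oU => z _; exact: continuous_rsubmx. Qed.

(** A partial derivative of the pullback is the pullback of the derivative along the projected basis
    vector, so [Ck_derive] feeds the induction. *)
Lemma Ck_rsubmx k U (f : 'rV[R]_m -> R) : open U -> Ck k U f ->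
  Ck k [set z : 'rV[R]_(1 + m) | U (rsubmx z)] (fun z => f (rsubmx z)).
Proof.
move=> oU; elim: k f => [|k ih] f Cf.
  move=> z Uz; apply: continuous_comp; first exact: continuous_rsubmx.
  exact: Cf.
split=> [z Uz|i].
  apply: (differentiable_comp (f := rsubmx) (g := f)).
    exact: differentiable_rsubmx.
  by case: Cf => + _; exact.
under [X in Ck _ _ X]eq_fun do rewrite derive_rsubmx.
exact: ih (Ck_derive _ oU Cf).
Qed.

Lemma smooth_rsubmx p q U (F : 'rV[R]_m -> 'M[R]_(p, q)) : open U ->
  smooth_on U F ->
  smooth_on [set z : 'rV[R]_(1 + m) | U (rsubmx z)] (fun z => F (rsubmx z)).
Proof. by move=> oU SF a b k; exact: Ck_rsubmx oU (SF a b k). Qed.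

Context {N : atlas R m}.
Variables (J g : field N m m) (tau : field N m 1) (i : idx N).
Hypothesis oi : open (img i).
Hypothesis Stau : smooth_on (img i) (tau i).

Let oL : open (@img _ _ (lift_atlas N) i) := open_rsubmx oi.

Lemma smooth_lift_eta : smooth_on (@img _ _ (lift_atlas N) i) (lift_eta tau i).
Proof.
apply: smoothD => //; first exact: smooth_cst.
by apply: smooth_mulmx => //; [exact: smooth_cst|exact: smooth_rsubmx].
Qed.

Lemma smooth_lift_phi : smooth_on (img i) (J i) ->
  smooth_on (@img _ _ (lift_atlas N) i) (lift_phi J tau i).
Proof.
move=> SJ; apply: smooth_mulmx => //.
  by apply: smooth_mulmx => //; [exact: smooth_cst|exact: smooth_rsubmx].
apply: smoothD => //; first exact: smooth_cst.
apply: smoothN => //; apply: smooth_mulmx => //; first exact: smooth_rsubmx.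
exact: smooth_cst.
Qed.

Lemma smooth_lift_metric : smooth_on (img i) (g i) ->
  smooth_on (@img _ _ (lift_atlas N) i) (lift_metric g tau i).
Proof.
move=> Sg; apply: smoothD => //.
  apply: smooth_mulmx => //; first exact: smooth_lift_eta.
  by apply: smooth_trmx; exact: smooth_lift_eta.
apply: smooth_mulmx => //; last exact: smooth_cst.
by apply: smooth_mulmx => //; [exact: smooth_cst|exact: smooth_rsubmx].
Qed.

End LiftSmooth.

(** * Connection and curvature of the lift *)

Section LiftGeometry.
Context {R : realType} {m : nat} {N : atlas R m}.
Variables (J g : field N m m) (tau : field N m 1).
Hypotheses (hg : almost_hermitian J g) (ftau : one_form tau).
Implicit Types (i : idx N) (z u v w : 'rV[R]_(1 + m)) (x a b : 'rV[R]_m).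

Local Notation P := (dproj R m).
Local Notation eta := (lift_eta tau).
Local Notation H := (hlift tau).
Local Notation G := (lift_metric g tau).

Lemma img_open i : open (img i).
Proof. exact: cimg_open (manifold_chart (hermitian_manifold hg) i). Qed.

Lemma smooth_g i : smooth_on (img i) (g i).
Proof. exact: (hermitian_g hg).1.1. Qed.

Lemma smooth_J i : smooth_on (img i) (J i).
Proof. exact: (hermitian_J hg).1. Qed.

Lemma smooth_tau i : smooth_on (img i) (tau i).
Proof. exact: ftau.1. Qed.

Lemma derivable_smooth p q i (F : 'rV[R]_m -> 'M[R]_(p, q)) x (a : 'rV[R]_m) :
  smooth_on (img i) F -> img i x -> derivable F x a.
Proof. by move=> SF ix; exact/diff_derivable/(smooth_differentiable SF). Qed.

Lemma unitmx_g i x : img i x -> g i x \in unitmx.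
Proof. by move=> ix; apply: posdef_unitmx; have [] := (hermitian_g hg).2 i x ix. Qed.

Lemma inner_sym i x a b : img i x -> inner (g i x) a b = inner (g i x) b a.
Proof. by move=> ix; have [] := (hermitian_g hg).2 i x ix. Qed.

Lemma mulmx_JJ i x a : img i x -> a *m J i x *m J i x = - a.
Proof. by move=> ix; rewrite -mulmxA (hermitian_J2 hg)// mulmxN mulmx1. Qed.

(** J is an isometry with square -1, hence skew. *)
Lemma inner_Jl i x a b : img i x ->
  inner (g i x) (a *m J i x) b = - inner (g i x) a (b *m J i x).
Proof.
move=> ix; rewrite -(hermitian_gJ hg ix a (b *m J i x)) mulmx_JJ// innerNr.
by rewrite opprK.
Qed.

Lemma inner_J0 i x a : img i x -> inner (g i x) a (a *m J i x) = 0.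
Proof.
move=> ix; have := inner_Jl a a ix; rewrite inner_sym// => h; lra.
Qed.

(** If [u] projects to a nonzero vector, g contributes a positive term; otherwise [u] is vertical
    and eta(u) is nonzero by [lift_ext]. *)
Lemma positive_lift i z u : img i (rsubmx z) -> u != 0 -> 0 < inner (G i z) u u.
Proof.
move=> iz u0; rewrite inner_lift.
have [_ gpos] := (hermitian_g hg).2 i _ iz.
have [uP|uP] := eqVneq (u *m P) 0.
  rewrite uP inner0l addr0 -expr2 lt_neqAle sqr_ge0 andbT eq_sym sqrf_eq0.
  apply: contraNN u0 => /eqP eu; apply/eqP; apply: (@lift_ext _ _ _ tau i z).
    by rewrite mul0mx.
  by rewrite eu /form mul0mx mxE.
by rewrite ltr_wpDl ?gpos// -expr2 sqr_ge0.
Qed.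

Lemma inner_derive_lift_metric i z u v w : img i (rsubmx z) ->
  inner ('D_u (G i) z) v w =
    form ('D_(u *m P) (tau i) (rsubmx z)) (v *m P) * form (eta i z) w
    + form (eta i z) v * form ('D_(u *m P) (tau i) (rsubmx z)) (w *m P)
    + inner ('D_(u *m P) (g i) (rsubmx z)) (v *m P) (w *m P).
Proof.
move=> iz.
have dt := @derivable_smooth _ _ _ _ _ (u *m P) (@smooth_tau i) iz.
have dg := @derivable_smooth _ _ _ _ _ (u *m P) (@smooth_g i) iz.
have D := is_derive_lift_metric dt dg.
rewrite (@derive_val _ _ _ _ _ _ _ D).
by rewrite !innerDm !inner_outer !form_mul inner_congr.
Qed.

Hypothesis dtau_kahler : forall i X Y,
  smooth_on (img i) X -> smooth_on (img i) Y -> forall x, img i x ->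
  inner (g i x) (X x) (Y x *m J i x) = ext_deriv (tau i) X Y x.

(** For constant fields the bracket term of [ext_deriv] vanishes and the antisymmetric part of the
    derivative of tau is left. *)
Lemma kahler_form i x a b : img i x ->
  inner (g i x) a (b *m J i x) =
  2^-1 * (form ('D_a (tau i) x) b - form ('D_b (tau i) x) a).
Proof.
move=> ix.
rewrite (@dtau_kahler i (cst a) (cst b) (smooth_cst _ a) (smooth_cst _ b) x ix).
have dt c : derivable (tau i) x c := derivable_smooth (smooth_tau i) ix.
rewrite /ext_deriv /lie !derive_cst subrr {3}/form mul0mx mxE subr0.
by rewrite (derive_form _ (dt a)) (derive_form _ (dt b)).
Qed.

(* Depends on the chart, and cancels from every tensorial expression. *)
Definition sym_dtau i x a b : R :=
  2^-1 * (form ('D_a (tau i) x) b + form ('D_b (tau i) x) a).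

(** In Koszul's formula the derivative of eta splits: its symmetric part is the coefficient of xi,
    and its antisymmetric part becomes omega by [kahler_form], which gives the two terms in J. *)
Lemma christoffel_lift i z u v : img i (rsubmx z) ->
  christoffel (G i) z u v =
  sym_dtau i (rsubmx z) (u *m P) (v *m P) *: lift_xi N i z
  + (christoffel (g i) (rsubmx z) (u *m P) (v *m P)
     - form (eta i z) v *: (u *m P *m J i (rsubmx z))
     - form (eta i z) u *: (v *m P *m J i (rsubmx z))) *m H i z.
Proof.
move=> iz; apply: christoffel_unique.
- have SG := smooth_lift_metric (@img_open i) (@smooth_tau i) (@smooth_g i).
  exact: smooth_differentiable SG iz.
- by apply: posdef_unitmx => w; exact: positive_lift.
move=> w; rewrite innerDl innerZl inner_lift_xi inner_hlift !innerDl !innerNl.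
rewrite !innerZl !inner_Jl// !kahler_form//.
have dg := smooth_differentiable (@smooth_g i) iz.
rewrite (inner_christoffel _ _ _ dg (unitmx_g iz)) /sym_dtau.
have := fun u' v' w' => @inner_derive_lift_metric i z u' v' w' iz.
(* With the derivatives generalized, a polynomial identity in their values is left. *)
move: (derive (G i) z) (derive (g i) (rsubmx z)) (derive (tau i) (rsubmx z)).
move=> DG Dg Dtau DGE.
rewrite /koszul !DGE; ring.
Qed.

Lemma christoffel_lift_dproj i z u v : img i (rsubmx z) ->
  christoffel (G i) z u v *m P =
  christoffel (g i) (rsubmx z) (u *m P) (v *m P)
  - form (eta i z) v *: (u *m P *m J i (rsubmx z))
  - form (eta i z) u *: (v *m P *m J i (rsubmx z)).
Proof.
move=> iz; rewrite christoffel_lift// mulmxDl -scalemxAl xi_dproj scaler0 add0r.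
by rewrite -mulmxA hlift_dproj mulmx1.
Qed.

Lemma christoffel_lift_eta i z u v : img i (rsubmx z) ->
  form (eta i z) (christoffel (G i) z u v) =
  sym_dtau i (rsubmx z) (u *m P) (v *m P).
Proof.
move=> iz; rewrite christoffel_lift// form_add form_scale /form xi_eta mxE mulr1.
by rewrite -mulmxA hlift_eta mulmx0 mxE addr0.
Qed.

Lemma derivable_lift_phi i z u : img i (rsubmx z) ->
  derivable (lift_phi J tau i) z u.
Proof.
move=> iz.
have SF := smooth_lift_phi (@img_open i) (@smooth_tau i) (@smooth_J i).
exact/diff_derivable/(smooth_differentiable SF).
Qed.

(** Both sides are the derivative of [phi_dproj], in which [P] is constant. *)
Lemma derive_phi_dproj i z u : img i (rsubmx z) ->
  'D_u (lift_phi J tau i) z *m P = P *m 'D_(u *m P) (J i) (rsubmx z).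
Proof.
move=> iz; have /derivableP dphi := @derivable_lift_phi i z u iz.
have dJ : derivable (J i) (rsubmx z) (u *m P) := derivable_smooth (@smooth_J i) iz.
have D := is_derive_mulmx (is_derive_cst P z u) (is_derive_rsubmx dJ).
have D' := is_derive_mulmx dphi (is_derive_cst P z u).
rewrite mulmx0 addr0 in D'; rewrite mul0mx add0r in D.
rewrite -[LHS](@derive_val _ _ _ _ _ _ _ D') -[RHS](@derive_val _ _ _ _ _ _ _ D).
by congr (derive _ z u); apply/funext => y; rewrite phi_dproj.
Qed.

Lemma derive_phi_eta i z u : img i (rsubmx z) ->
  'D_u (lift_phi J tau i) z *m eta i z =
  - (P *m J i (rsubmx z) *m 'D_(u *m P) (tau i) (rsubmx z)).
Proof.
(* Differentiate [phi *m eta = 0]. *)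
move=> iz; have /derivableP dphi := @derivable_lift_phi i z u iz.
have dt : derivable (tau i) (rsubmx z) (u *m P) :=
  derivable_smooth (@smooth_tau i) iz.
have D := is_derive_mulmx dphi (is_derive_lift_eta dt).
apply/eqP; rewrite -addr_eq0; apply/eqP.
rewrite -(phi_dproj J tau) -mulmxA -[LHS](@derive_val _ _ _ _ _ _ _ D).
rewrite (_ : (fun _ => _) = cst 0) ?derive_cst//.
by apply/funext => y; rewrite phi_eta.
Qed.

(** The fields [v] and [w] have constant coordinates and are horizontal at [z] only, so eta(v) and
    eta(w) vary with the point: differentiating them produces the terms in [T]. *)
Lemma derive_christoffel_lift i z u v w : img i (rsubmx z) ->
  form (eta i z) v = 0 -> form (eta i z) w = 0 ->
  let T a b := form ('D_a (tau i) (rsubmx z)) b in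
  'D_u (fun y => christoffel (G i) y v w) z *m P =
  'D_(u *m P) (fun x => christoffel (g i) x (v *m P) (w *m P)) (rsubmx z)
  - T (u *m P) (w *m P) *: (v *m P *m J i (rsubmx z))
  - T (u *m P) (v *m P) *: (w *m P *m J i (rsubmx z)).
Proof.
move=> iz ev ew T.
have eta0 r : form (eta i z) r = 0 -> r *m eta i z = 0.
  by move=> er; rewrite [LHS]mx11_scalar -[_ 0 0]/(form _ _) er raddf0.
have oL := open_rsubmx (@img_open i).
have dC : derivable (fun y => christoffel (G i) y v w) z u.
  apply: (derivable_christoffel oL) iz.
    exact: smooth_lift_metric (@img_open i) (@smooth_tau i) (@smooth_g i).
  by move=> y iy; apply: posdef_unitmx => r; exact: positive_lift.
have D1 := is_derive_mulmx (derivableP dC) (is_derive_cst P z u).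
rewrite mulmx0 addr0 in D1.
have dt : derivable (tau i) (rsubmx z) (u *m P) :=
  derivable_smooth (@smooth_tau i) iz.
have dJ : derivable (J i) (rsubmx z) (u *m P) := derivable_smooth (@smooth_J i) iz.
have De := is_derive_lift_eta dt.
(* In the product rule, the derivative of J comes with the factor eta(r), which is 0 at [z]. *)
have Dr r s : r *m eta i z = 0 ->
    is_derive z u (fun y => r *m eta i y *m (s *m P *m J i (rsubmx y)))
      (T (u *m P) (r *m P) *: (s *m P *m J i (rsubmx z))).
  move=> r0.
  have E1 := is_derive_mulmx (is_derive_cst r z u) De.
  have E2 := is_derive_mulmx (is_derive_cst (s *m P) z u) (is_derive_rsubmx dJ).
  have E := is_derive_mulmx E1 E2.
  rewrite r0 mul0mx addr0 mul0mx add0r -form_scaler form_mul in E.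
  exact: E.
have dG : derivable (fun x => christoffel (g i) x (v *m P) (w *m P))
    (rsubmx z) (u *m P).
  exact: derivable_christoffel (@img_open i) (@smooth_g i) (@unitmx_g i) iz.
have D2 := is_deriveB (is_deriveB (is_derive_rsubmx dG) (Dr w v (eta0 _ ew)))
  (Dr v w (eta0 _ ev)).
rewrite -[LHS](@derive_val _ _ _ _ _ _ _ D1) -[RHS](@derive_val _ _ _ _ _ _ _ D2).
(* The projected formula holds only on the image of the chart, a neighbourhood of [z]. *)
apply: near_eq_derive; apply: filterS (open_nbhs_nbhs (conj oL iz)) => y iy.
by rewrite christoffel_lift_dproj// !form_scaler.
Qed.

(** Each of the four terms of [curvature_cst] is its counterpart on N plus corrections from the
    derivative of tau; the corrections add up to a multiple of omega. *)
Lemma curvature_lift_dproj i z u v : img i (rsubmx z) ->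
  form (eta i z) u = 0 -> form (eta i z) v = 0 ->
  curvature (G i) (cst u) (cst v) (cst v) z *m P =
  curvature (g i) (cst (u *m P)) (cst (v *m P)) (cst (v *m P)) (rsubmx z)
  - (3 * inner (g i (rsubmx z)) (u *m P) (v *m P *m J i (rsubmx z)))
      *: (v *m P *m J i (rsubmx z)).
Proof.
move=> iz eu ev.
set x := rsubmx z; set a := u *m P; set b := v *m P.
have D1 := @derive_christoffel_lift i z u v v iz ev ev.
have D2 := @derive_christoffel_lift i z v u v iz eu ev.
have C1 : christoffel (G i) z u (christoffel (G i) z v v) *m P =
    christoffel (g i) x a (christoffel (g i) x b b)
    - sym_dtau i x b b *: (a *m J i x).
  rewrite christoffel_lift_dproj// christoffel_lift_eta//.
  by rewrite christoffel_lift_dproj// eu ev !scale0r !subr0.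
have C2 : christoffel (G i) z v (christoffel (G i) z u v) *m P =
    christoffel (g i) x b (christoffel (g i) x a b)
    - sym_dtau i x a b *: (b *m J i x).
  rewrite christoffel_lift_dproj// christoffel_lift_eta//.
  by rewrite christoffel_lift_dproj// eu ev !scale0r !subr0.
(* Here p, q, r stand for T(a,b), T(b,a), T(b,b), with T the derivative of tau, and U = Ja, V = Jb.
   The terms in U cancel, while V gets -2p + q + (p + q)/2 = -3(p - q)/2, that is -3 omega(a,b). *)
have sumP (A B C D : 'rV[R]_(1 + m)) (A' B' C' D' U V : 'rV[R]_m) p q r :
    A *m P = A' - p *: V - p *: V ->
    B *m P = B' - (2^-1 * (r + r)) *: U ->
    C *m P = C' - r *: U - q *: V ->
    D *m P = D' - (2^-1 * (p + q)) *: V ->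
    (A + B - (C + D)) *m P = A' + B' - (C' + D') - (3 * (2^-1 * (p - q))) *: V.
  rewrite mulmxBl !mulmxDl => -> -> -> ->.
  by apply/rowP => l; rewrite !mxE; field.
rewrite (curvature_cst (G i)) (curvature_cst (g i)) (kahler_form a b iz).
exact: sumP D1 C1 D2 C2.
Qed.

(** With a the projection of [v] and b = Ja, omega(a,b) = g(a, Jb) = -1 and Jb = -a, so the
    correction to the curvature is -3a, of product -3 with a. The area of the plane is 1 on both
    manifolds. *)
Lemma sectional_lift i z v c : img i (rsubmx z) ->
  form (eta i z) v = 0 -> inner (G i z) v v = 1 ->
  sectional (g i) (rsubmx z) (v *m P) (v *m P *m J i (rsubmx z)) = c ->
  sectional (G i) z v (v *m lift_phi J tau i z) = c - 3.
Proof.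
move=> iz ev v1 <-.
have ephi : form (eta i z) (v *m lift_phi J tau i z) = 0.
  by rewrite /form -mulmxA phi_eta mulmx0 mxE.
have phiP : v *m lift_phi J tau i z *m P = v *m P *m J i (rsubmx z).
  by rewrite -mulmxA phi_dproj mulmxA.
have gv : inner (g i (rsubmx z)) (v *m P) (v *m P) = 1.
  by move: v1; rewrite inner_lift ev mul0r add0r.
rewrite /sectional !inner_lift ev ephi !(mul0r, mulr0, add0r) phiP.
rewrite (curvature_lift_dproj iz ev ephi) phiP.
rewrite (hermitian_gJ hg)// inner_J0// mulmx_JJ// innerNr gv.
rewrite innerDl innerNl innerZl innerNl gv.
rewrite expr0n mulr1 subr0 !divr1.
by rewrite !mulrN !mulr1 opprK.
Qed.

Hypothesis J_parallel : forall i X Y,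
  smooth_on (img i) X -> smooth_on (img i) Y -> forall x, img i x ->
  cov11 (g i) (J i) X Y x = 0.

Lemma kahler_parallel i x a b : img i x ->
  b *m 'D_a (J i) x + christoffel (g i) x a (b *m J i x) =
  christoffel (g i) x a b *m J i x.
Proof.
move=> ix.
have := @J_parallel i (cst a) (cst b) (smooth_cst _ a) (smooth_cst _ b) x ix.
rewrite cov11E; first by move/subr0_eq.
  exact: derivable_smooth (smooth_J i) ix.
exact: derivable_cst.
Qed.

(** The identity is tensorial by [cov11E], so it is checked on vectors, through the projection to N
    and then through eta. *)
Lemma cov11_lift i (X Y : 'rV[R]_(1 + m) -> 'rV[R]_(1 + m)) z :
  img i (rsubmx z) -> derivable Y z (X z) ->
  cov11 (G i) (lift_phi J tau i) X Y z =
  inner (G i z) (X z) (Y z) *: lift_xi N i z - form (eta i z) (Y z) *: X z.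
Proof.
move=> iz dY.
rewrite (cov11E _ (derivable_lift_phi iz) dY); move: (X z) (Y z) => {dY}u v.
have vphiP : v *m lift_phi J tau i z *m P = v *m P *m J i (rsubmx z).
  by rewrite -mulmxA phi_dproj mulmxA.
have etaphi w : form (eta i z) (w *m lift_phi J tau i z) = 0.
  by rewrite /form -mulmxA phi_eta mulmx0 mxE.
apply: (@lift_ext _ _ _ tau i z).
  (* Projection to N: the terms of N cancel since J is parallel, the two terms in eta(u) cancel
     since J has square -1, and -eta(v) times the projection of u is left. *)
  rewrite !mulmxBl mulmxDl -!scalemxAl xi_dproj scaler0 sub0r.
  rewrite -(mulmxA v) derive_phi_dproj// mulmxA christoffel_lift_dproj//.
  rewrite vphiP etaphi -(mulmxA _ _ P) phi_dproj mulmxA christoffel_lift_dproj//.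
  rewrite scale0r subr0 !addrA kahler_parallel//.
  rewrite !mulmxBl -!scalemxAl !mulmx_JJ// !scalerN !opprK.
  rewrite !opprD !addrA.
  set b := _ *: (v *m P).
  by rewrite [_ *m _ + b]addrC addrK addrAC subrr sub0r.
(* Component along eta: the derivative of phi and [sym_dtau] combine to -omega(a, Jb) = g(a, b), for
   a and b the projections of u and v. *)
rewrite (form_sub _ (_ *: _)) (form_sub _ (_ + _)) form_add etaphi subr0.
rewrite christoffel_lift_eta// vphiP 2!form_scale inner_lift.
have -> : form (eta i z) (lift_xi N i z) = 1 by rewrite /form xi_eta mxE.
have -> : form (eta i z) (v *m 'D_u (lift_phi J tau i) z) =
    - form ('D_(u *m P) (tau i) (rsubmx z)) (v *m P *m J i (rsubmx z)).
  rewrite /form -mulmxA derive_phi_eta// mulmxN mxE.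
  by rewrite !mulmxA.
have := @kahler_form i (rsubmx z) (u *m P) (v *m P *m J i (rsubmx z)) iz.
rewrite mulmx_JJ// innerNr /sym_dtau.
move: (derive (tau i) (rsubmx z)) => D /eqP; rewrite eqr_oppLR => /eqP ->.
by field.
Qed.

End LiftGeometry.

(** * The manifold R x N *)

Section ProductTopology.

(** Cylinders over neighbourhoods in one factor turn a cluster point of the product into a cluster
    point of that factor. *)
Lemma hausdorff_prod (S T : topologicalType) :
  hausdorff_space S -> hausdorff_space T -> hausdorff_space (S * T)%type.
Proof.
move=> hS hT [s t] [s' t'] st; congr pair.
  apply: hS => A B sA s'B.
  have [[a b] [[Aa _] [Ba _]]] :
      (A `*` [set: T]) `&` (B `*` [set: T]) !=set0.
    by apply: st; [exists (A, setT)|exists (B, setT)] => //; split=> //;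
      exact: filterT.
  by exists a.
apply: hT => A B tA t'B.
have [[a b] [[_ Ab] [_ Bb]]] : ([set: S] `*` A) `&` ([set: S] `*` B) !=set0.
  by apply: st; [exists (setT, A)|exists (setT, B)] => //; split=> //;
    exact: filterT.
by exists b.
Qed.

Lemma second_countable_prod (S T : topologicalType) :
  @second_countable S -> @second_countable T ->
  @second_countable (S * T)%type.
Proof.
move=> [A cA [oA bA]] [B cB [oB bB]].
exists ((fun UV => UV.1 `*` UV.2) @` (A `*` B)).
  exact/(card_le_trans (card_image_le _ _))/countableX.
split=> [_ [[U V] [/= AU BV] <-]|[s t] W [[P Q] [/= sP tQ] PQW]].
  rewrite openE => -[s t] [/= Us Vt]; exists (U, V) => //=; split;
    apply: open_nbhs_nbhs; split=> //; by [exact: oA|exact: oB].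
have [U [AU Us] UP] := bA s _ sP; have [V [BV Vt] VQ] := bB t _ tQ.
exists (U `*` V); first by split=> //; exists (U, V).
by move=> [a b] [/= /UP Pa /VQ Qb]; exact: PQW.
Qed.

Lemma second_countable_real (R : realType) : @second_countable R.
Proof.
exists (range (fun q : rat * rat => `]ratr q.1, ratr q.2[%classic : set R)).
  exact/(card_le_trans (card_image_le _ _))/countableP.
split=> [_ [q _ <-]|x W /nbhs_ballP[e /= e0 xeW]].
  exact: interval_open.
have /rat_in_itvoo[p] : x - e < x by rewrite ltrBlDr ltrDl.
have /rat_in_itvoo[q] : x < x + e by rewrite ltrDl.
rewrite !in_itv/= => /andP[xq qe] /andP[ep px].
exists `]ratr p, ratr q[%classic.
  by split; [exists (p, q)|rewrite /= in_itv/= px].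
move=> y /=; rewrite in_itv/= => /andP[py yq]; apply: xeW.
rewrite /ball/= ltr_distlC; apply/andP; split.
  exact: lt_trans py.
exact: lt_trans qe.
Qed.

Lemma cvg_mx (T U : topologicalType) m n (F : T -> 'M[U]_(m, n)) x :
  (forall i j, (fun y => F y i j) @ x --> F x i j) -> F @ x --> F x.
Proof.
move=> Fx A [B FB BA]; rewrite /nbhs/=.
have : \forall y \near x, forall i j, B i j (F y i j).
  by apply: filter_forall => i; apply: filter_forall => j; exact: Fx (FB i j).
by apply: filterS => y By; exact: BA.
Qed.

End ProductTopology.

(** * Charts and transition maps of the product *)

Section LiftManifold.
Context {R : realType} {m : nat} {N : atlas R m}.
Hypothesis mN : smooth_manifold N.
Implicit Types (i j : idx N) (z u v w : 'rV[R]_(1 + m)).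

Local Notation P := (dproj R m).

Lemma open_overlap i j : open (overlap i j).
Proof.
rewrite openE => x [ix jx]; apply: filterI.
  by apply: open_nbhs_nbhs; split=> //; exact: cimg_open (manifold_chart mN i).
apply: (cinv_continuous (manifold_chart mN i) ix); apply: open_nbhs_nbhs.
by split=> //; exact: cdom_open (manifold_chart mN j).
Qed.

Lemma is_chart_lift i : is_chart (lift_chart i).
Proof.
have ci := manifold_chart mN i; split=> /=.
- apply: open_comp (cdom_open ci) => p _; exact: cvg_snd.
- exact: open_rsubmx (cimg_open ci).
- move=> [t p] /= /(cmapK ci)[ip pK]; rewrite row_mxKr; split=> //.
  rewrite pK; congr pair.
  by rewrite mxE; case: splitP => k // _; rewrite mxE.
- move=> z /(cinvK ci)[iz zK]; split=> //; rewrite zK -[RHS]hsubmxK.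
  congr row_mx; apply/rowP => k; rewrite !mxE (ord1 k).
  by congr (z _ _); exact: val_inj.
- move=> [t p] /= ip; apply: cvg_mx => a b.
  case: (split_ordP b) => k ->.
    rewrite row_mxEl mxE; under eq_fun do rewrite row_mxEl mxE.
    exact: cvg_fst.
  rewrite row_mxEr; under eq_fun do rewrite row_mxEr.
  apply: (@continuous_comp _ _ _ (fun q : R * N => cmap (chart_of i) q.2)
     (fun M : 'rV[R]_m => M a k)); last exact: coord_continuous.
  apply: (@continuous_comp _ _ _ snd); first exact: cvg_snd.
  exact: (cmap_continuous ci).
- move=> z iz.
  have cz : {for z, continuous (fun y => cinv (chart_of i) (rsubmx y))}.
    apply: (@continuous_comp _ _ _ rsubmx); first exact: continuous_rsubmx.
    exact: (cinv_continuous ci).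
  have cz0 : {for z, continuous (fun y : 'rV[R]_(1 + m) => y 0 0)}.
    exact: coord_continuous.
  exact: cvg_pair cz0 cz.
Qed.

Definition vertical : 'M[R]_(1 + m) := col_mx 1%:M 0 *m row_mx 1%:M 0.

(** A change of charts fixes t. The matrix form makes the rules for sums and products of matrices
    applicable. *)
Lemma lift_transitionE i j z :
  @transition _ _ (lift_atlas N) i j z =
  z *m vertical + transition i j (rsubmx z) *m incl R m.
Proof.
rewrite /vertical mulmxA -[z in RHS]hsubmxK mul_row_col mulmx1 mulmx0 addr0.
rewrite row_mxKr /incl !mul_mx_row !mulmx1 !mulmx0 add_row_mx addr0 add0r.
congr row_mx; apply/rowP => k; rewrite !mxE (ord1 k).
by congr (z _ _); exact: val_inj.
Qed.

Lemma smooth_lift_transition i j :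
  smooth_on (@overlap _ _ (lift_atlas N) i j)
            (@transition _ _ (lift_atlas N) i j).
Proof.
have oL := open_rsubmx (@open_overlap i j).
rewrite (_ : @transition _ _ (lift_atlas N) i j = fun z =>
  z *m vertical + transition i j (rsubmx z) *m incl R m); last first.
  by apply/funext => z; exact: lift_transitionE.
apply: (smoothD oL).
  apply: (smooth_mulmx oL); last exact: smooth_cst.
  by move=> a b k; exact: Ck_coord.
apply: (smooth_mulmx oL); last exact: smooth_cst.
exact: smooth_rsubmx (@open_overlap i j) (manifold_transition mN i j).
Qed.

Lemma smooth_manifold_lift : smooth_manifold (lift_atlas N).
Proof.
split.
- exact: hausdorff_prod (@Rhausdorff R) (manifold_hausdorff mN).
- exact: second_countable_prod (@second_countable_real R)
    (manifold_second_countable mN).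
- by move=> p; have [i ip] := manifold_cover mN p.2; exists i.
- exact: is_chart_lift.
- exact: smooth_lift_transition.
Qed.

(** Block diagonal, with blocks 1 and the Jacobian on N; row k is found as the derivative along the
    k-th basis vector. *)
Lemma jacobian_lift i j z : overlap i j (rsubmx z) ->
  'J (@transition _ _ (lift_atlas N) i j) z =
  vertical + P *m 'J (transition i j) (rsubmx z) *m incl R m.
Proof.
move=> ijz; have dT := smooth_differentiable (manifold_transition mN i j) ijz.
have dL := smooth_differentiable (smooth_lift_transition i j) ijz.
apply/row_matrixP => k; rewrite !rowE -deriveEjacobian//.
set u := delta_mx 0 k.
have D1 := is_derive_mulmx (is_derive_id z u) (is_derive_cst vertical z u).
have dTu : derivable (transition i j) (rsubmx z) (u *m P) by exact: diff_derivable.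
have D2 := is_derive_mulmx (is_derive_rsubmx dTu) (is_derive_cst (incl R m) z u).
have D := is_deriveD D1 D2.
rewrite mulmx0 addr0 mulmx0 addr0 in D.
rewrite mulmxDr (mulmxA u (P *m _)) (mulmxA u P) -(deriveEjacobian _ dT).
rewrite -[RHS](@derive_val _ _ _ _ _ _ _ D).
congr (derive _ z u); apply/funext => y; exact: lift_transitionE.
Qed.

End LiftManifold.

(** * Transformation laws of the lifted tensors *)

Section LiftTensors.
Context {R : realType} {m : nat} {N : atlas R m}.
Hypothesis mN : smooth_manifold N.
Variables (J g : field N m m) (tau : field N m 1).
Implicit Types (i j : idx N) (z : 'rV[R]_(1 + m)).

Local Notation P := (dproj R m).
Local Notation T i j := (@transition _ _ (lift_atlas N) i j).
Local Notation E := (col_mx 1%:M 0 : 'M[R]_(1 + m, 1)).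

Lemma rsubmx_transition i j z :
  rsubmx (T i j z) = transition i j (rsubmx z).
Proof. by rewrite row_mxKr. Qed.

Lemma jacobian_lift_dproj i j z : overlap i j (rsubmx z) ->
  'J (T i j) z *m P = P *m 'J (transition i j) (rsubmx z).
Proof.
move=> ijz; rewrite jacobian_lift// mulmxDl /vertical -!mulmxA.
by rewrite !mul_row_col !(mul0mx, mulmx0, addr0, add0r, mulmx1).
Qed.

Lemma xi_jacobian_lift i j z : overlap i j (rsubmx z) ->
  lift_xi N i z *m 'J (T i j) z = lift_xi N i z.
Proof.
move=> ijz; rewrite jacobian_lift// mulmxDr !mulmxA xi_dproj !mul0mx addr0.
by rewrite mul_row_col mul0mx addr0 !mul1mx.
Qed.

Lemma incl_jacobian_lift i j z : overlap i j (rsubmx z) ->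
  incl R m *m 'J (T i j) z = 'J (transition i j) (rsubmx z) *m incl R m.
Proof.
move=> ijz; rewrite jacobian_lift// mulmxDr !mulmxA !mul_row_col.
by rewrite !(mulmx0, mul0mx, add0r, mul1mx).
Qed.

Lemma jacobian_lift_vert i j z : overlap i j (rsubmx z) ->
  'J (T i j) z *m E = E.
Proof.
move=> ijz; rewrite jacobian_lift// mulmxDl -!mulmxA !mul_row_col.
by rewrite !(mul0mx, mulmx0, addr0, mulmx1).
Qed.

Lemma vector_field_lift_xi : vector_field (lift_xi N).
Proof.
split=> [i|i j z ijz]; first exact: smooth_cst.
by rewrite xi_jacobian_lift.
Qed.

(** The summand dt is invariant because t is fixed, and tau is a form on N. *)
Lemma lift_eta_transition i j z : one_form tau -> overlap i j (rsubmx z) ->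
  lift_eta tau i z = 'J (T i j) z *m lift_eta tau j (T i j z).
Proof.
move=> [_ tauT] ijz; rewrite /lift_eta mulmxDr jacobian_lift_vert// mulmxA.
by rewrite jacobian_lift_dproj// -mulmxA rsubmx_transition -tauT.
Qed.

Lemma hlift_transition i j z : one_form tau -> overlap i j (rsubmx z) ->
  hlift tau i z *m 'J (T i j) z =
  'J (transition i j) (rsubmx z) *m hlift tau j (T i j z).
Proof.
move=> [_ tauT] ijz; rewrite /hlift mulmxBl mulmxBr incl_jacobian_lift//.
by rewrite -mulmxA xi_jacobian_lift// rsubmx_transition mulmxA -tauT.
Qed.

Lemma one_form_lift_eta : one_form tau -> one_form (lift_eta tau).
Proof.
move=> ftau; split=> [i|i j z ijz]; last exact: lift_eta_transition.
exact: smooth_lift_eta (cimg_open (manifold_chart mN i)) (ftau.1 i).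
Qed.

Lemma tensor11_lift_phi : one_form tau -> tensor11 J ->
  tensor11 (lift_phi J tau).
Proof.
move=> ftau [SJ JT]; split=> [i|i j z ijz].
  exact: smooth_lift_phi (cimg_open (manifold_chart mN i)) (ftau.1 i) (SJ i).
rewrite /lift_phi -mulmxA hlift_transition// !mulmxA jacobian_lift_dproj//.
by rewrite rsubmx_transition -!mulmxA (mulmxA (J i _)) JT// -!mulmxA.
Qed.

Lemma tensor02_lift_metric : one_form tau -> tensor02 g ->
  tensor02 (lift_metric g tau).
Proof.
move=> ftau [Sg gT]; split=> [i|i j z ijz].
  exact: smooth_lift_metric (cimg_open (manifold_chart mN i)) (ftau.1 i) (Sg i).
rewrite /lift_metric (lift_eta_transition ftau ijz).
move: (lift_eta tau j _) => e; rewrite mulmxDr mulmxDl.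
congr (_ + _); first by rewrite trmx_mul !mulmxA.
rewrite (gT _ _ _ ijz) rsubmx_transition !mulmxA jacobian_lift_dproj// -!mulmxA.
by rewrite -!trmx_mul jacobian_lift_dproj.
Qed.

End LiftTensors.

(** * The almost contact metric structure and the theorem *)

Lemma almost_contact_lift (R : realType) (m : nat) (N : atlas R m)
    (J g : field N m m) (tau : field N m 1) :
  almost_hermitian J g -> one_form tau ->
  almost_contact_metric (lift_phi J tau) (lift_xi N) (lift_eta tau)
    (lift_metric g tau).
Proof.
move=> hg ftau; have mN := hermitian_manifold hg.
have phiP i z w : w *m lift_phi J tau i z *m dproj R m =
    w *m dproj R m *m J i (rsubmx z) by rewrite -mulmxA phi_dproj mulmxA.
have ephi i z w : form (lift_eta tau i z) (w *m lift_phi J tau i z) = 0.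
  by rewrite /form -mulmxA phi_eta mulmx0 mxE.
split.
- exact: smooth_manifold_lift.
- exact: tensor11_lift_phi (hermitian_J hg).
- exact: vector_field_lift_xi.
- exact: one_form_lift_eta.
- split; first exact: tensor02_lift_metric (hermitian_g hg).1.
  move=> i z iz; split; last by move=> u u0; exact: (positive_lift tau hg iz u0).
  by move=> u v; rewrite !inner_lift (inner_sym hg _ _ iz) mulrC.
- move=> i z iz u; apply: (@lift_ext _ _ _ tau i z).
    rewrite !phiP (mulmx_JJ hg _ iz) mulmxDl mulNmx -scalemxAl xi_dproj.
    by rewrite scaler0 addr0.
  rewrite ephi form_add form_scale /form xi_eta mulNmx !mxE mulr1.
  by rewrite addNr.
- by move=> i z iz; rewrite /form xi_eta mxE.
- move=> i z iz u v; rewrite !inner_lift !ephi mul0r add0r !phiP.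
  by rewrite (hermitian_gJ hg)// [RHS]addrAC subrr add0r.
Qed.

Theorem theorem1 (R : realType) (n : nat) (N : atlas R n.*2)
    (J g : field N n.*2 n.*2) (tau : field N n.*2 1) (c : R) :
  kahler J g ->
  kahler_potential J g tau ->
  const_hol_curvature J g c ->
  sasakian (lift_phi J tau) (lift_xi N) (lift_eta tau) (lift_metric g tau) /\
  const_phi_curvature (lift_phi J tau) (lift_eta tau) (lift_metric g tau) (c - 3).
Proof.
move=> [hg Jpar] [ftau dtau] cg; split; first split.
- exact: almost_contact_lift.
- move=> i X Y SX SY z iz; apply: (cov11_lift hg ftau dtau Jpar) => //.
  exact/diff_derivable/(smooth_differentiable SY).
move=> i z iz v ev v1; apply: (sectional_lift hg ftau dtau) => //.
(* A horizontal vector with zero projection has norm 0 rather than 1, so the projection of [v] spans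
   a holomorphic plane of N. *)
apply: cg => //; apply: contra_eq_neq v1 => vP.
by rewrite inner_lift ev vP inner0l mulr0 addr0 eq_sym oner_neq0.
Qed.
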